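(* Let $\Psi:(0,\infty)\to(0,\infty)$ and $\omega:(0,\infty)\to(0,1)$ satisfy $\lim_{q\to\infty} q^{2}\Psi(q)=\lim_{q\to\infty}\omega(q)=0$, suppose that $q\mapsto q^{2}\Psi(q)$ is non-increasing, and suppose that $\Psi$ satisfies the square divisibility condition. Then: (1) If $$\omega(q)<\frac{1-\omega\left(\frac{1}{\Psi(q)}\right)}{\Psi(q)}\Psi\left(\frac{1}{\Psi(q)}\right)$$ for all $q$ sufficiently large, then $E(\Psi,\omega)=\emptyset$. In particular, if there is $c\in(0,1)$ with $\omega(q)<\frac{c}{\Psi(q)}\Psi\left(\frac{1}{\Psi(q)}\right)$ for all $q$ sufficiently large, then $E(\Psi,\omega)=\emptyset$. (2) If $$\omega(q)\geq\frac{45}{16\Psi(q)}\Psi\left(\frac{1}{8\Psi(q)}\right)$$ for all $q$ sufficiently large, then $E(\Psi,\omega)$ is non-empty and uncountable.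
   Context: $\Psi$ satisfies the square divisibility condition if for every $q\in\mathbb{N}$, $\Psi(q)^{-1}$ is an integer divisible by $q^{2}$. $W(\Psi)$ denotes the set of $x\in\mathbb{R}$ with $|x-p/q|\le\Psi(q)$ for infinitely many $(p,q)\in\mathbb{Z}\times\mathbb{N}$. $E(\Psi,\omega)$ denotes the set of $x\in W(\Psi)$ such that for all $q\in\mathbb{N}$ sufficiently large, $|x-p/q|\ge(1-\omega(q))\Psi(q)$ for all $p\in\mathbb{Z}$. *)

(* Defs.v *)
From HB Require Import structures.
From mathcomp Require Import all_boot all_order all_algebra.
From mathcomp Require Import all_classical all_reals all_analysis.

Set Implicit Arguments.
Unset Strict Implicit.
Unset Printing Implicit Defensive.

Import Order.TTheory GRing.Theory Num.Theory.
Import numFieldNormedType.Exports.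

Local Open Scope classical_set_scope.
Local Open Scope ring_scope.

(* A function (0, oo) -> (0, oo) is encoded as a total function R -> R that is
   positive at positive arguments; its values at arguments <= 0 are junk and
   are never used. The paper's natural numbers start at 1. *)

Definition square_divisibility (R : realType) (Psi : R -> R) : Prop :=
  forall q : nat, (0 < q)%N ->
    exists2 n : int, (Psi q%:R)^-1 = n%:~R & ((q ^ 2)%N%:Z %| n)%Z.

(* The pairs (p, q) need not be coprime. *)
Definition W (R : realType) (Psi : R -> R) : set R :=
  [set x | infinite_set [set pq : int * nat |
     (0 < pq.2)%N /\ `|x - pq.1%:~R / pq.2%:R| <= Psi pq.2%:R]].

Definition E (R : realType) (Psi omega : R -> R) : set R :=
  [set x | W Psi x /\
     exists q0 : nat, forall q : nat, (0 < q)%N -> (q0 <= q)%N ->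
       forall p : int,
         (1 - omega q%:R) * Psi q%:R <= `|x - p%:~R / q%:R|].

(* Main.v *)
(** Write [f q = q^2 Psi q]. By square divisibility [Psi q = 1 / N] with
    [N = q^2 m] an integer, so [p / q +- Psi q] is itself a fraction with
    denominator [N].

    (1) If [x] lies in [E] and [|x - p / q| <= Psi q], then [x] is within
    [omega q / N] of the fraction [p / q +- 1 / N]; being at least
    [(1 - omega N) Psi N] away from it forces a lower bound on [omega q].

    (2) A point avoiding any given sequence is built by nested intervals
    ("cells" of length [1 / (18 r^2)], whose points stay away from all
    fractions of denominator less than [r]). A cell is first replaced
    repeatedly by one of its ninths, which keeps it away from fractions up to
    a constant and lets it avoid one more term of the sequence; Dirichlet's
    theorem then gives a fraction [p / q] in the cell that is well separated
    from the fractions of smaller denominator, and the next cell is placed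
    just to the left of [p / q + Psi q]. *)
Require Import Defs.
From HB Require Import structures.
From mathcomp Require Import all_boot all_order all_algebra.
From mathcomp Require Import all_classical all_reals all_analysis.
From mathcomp Require Import ring lra zify.

Set Implicit Arguments.
Unset Strict Implicit.
Unset Printing Implicit Defensive.

Import Order.TTheory GRing.Theory Num.Theory.
Import numFieldNormedType.Exports.

Local Open Scope classical_set_scope.
Local Open Scope ring_scope.

(** * Separation of fractions, and subcells far from them *)

Lemma dist_fractions (R : realFieldType) (b b' : int) (t t' : nat) :
  (0 < t)%N -> (0 < t')%N -> b%:~R / t%:R != b'%:~R / t'%:R :> R ->
  (t%:R * t'%:R)^-1 <= `|b%:~R / t%:R - b'%:~R / t'%:R| :> R.
Proof.
move=> t0 t'0 ne.
have tR : 0 < t%:R :> R by rewrite ltr0n.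
have tR' : 0 < t'%:R :> R by rewrite ltr0n.
have e : b%:~R / t%:R - b'%:~R / t'%:R
    = (b * t'%:Z - b' * t%:Z)%:~R / (t%:R * t'%:R) :> R.
  by rewrite intrB !intrM -!pmulrn; field; rewrite !gt_eqF.
rewrite e normrM normfV (gtr0_norm (mulr_gt0 tR tR')).
apply: ler_peMl; first by rewrite invr_ge0 mulr_ge0 ?ltW.
rewrite -intr_norm ler1z -gtz0_ge1 normr_gt0.
apply: contra_neq ne => z.
by apply/eqP; rewrite -subr_eq0 e z mul0r.
Qed.

(** Only the ninths starting at [a], [a + 4 l] and [a + 8 l] compete. They are so far apart that [v]
    comes closer than [l] to at most one of them and [y] lies in at most one, so a third is left. *)
Lemma three_pieces (R : realFieldType) (a l e v y : R) : 0 < l -> 0 <= e <= l ->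
  exists a', [/\ a <= a', a' + l <= a + 9 * l &
    forall x, a' <= x <= a' + l -> x != y /\ e <= `|x - v|].
Proof.
move=> l0 /andP[e0 el].
have K (k : R) : 0 <= k <= 8 ->
    (v <= a + (k - 1) * l \/ a + (k + 2) * l <= v) ->
    (y < a + k * l \/ a + (k + 1) * l < y) ->
  exists a', [/\ a <= a', a' + l <= a + 9 * l &
    forall x, a' <= x <= a' + l -> x != y /\ e <= `|x - v|].
  move=> k08 hv hy; exists (a + k * l); split; [nra|nra|move=> x /andP[x1 x2]; split].
    by case: hy => hy; apply/eqP; nra.
  case: hv => hv; first by apply: le_trans (ler_norm _); nra.
  by rewrite distrC; apply: le_trans (ler_norm _); nra.
have [v1|v1] := leP v (a + 5 / 2 * l); have [y1|y1] := leP y (a + 5 / 2 * l).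
- by apply: (K 8); [lra|left; nra|left; nra].
- have [y2|y2] := leP y (a + 13 / 2 * l).
    by apply: (K 8); [lra|left; nra|left; nra].
  by apply: (K 4); [lra|left; nra|right; nra].
- have [v2|v2] := leP v (a + 13 / 2 * l).
    by apply: (K 8); [lra|left; nra|left; nra].
  by apply: (K 4); [lra|right; nra|left; nra].
- by apply: (K 0); [lra|right; nra|right; nra].
Qed.

(* Fractions with denominators less than [3 r] are more than [1 / (9 r^2)]
   apart, so at most one of them is near the cell. *)
Lemma subcell_away (R : realFieldType) (a y : R) (r : nat) : (0 < r)%N ->
  exists a', [/\ a <= a',
    a' + (18 * (3 * r)%:R ^+ 2)^-1 <= a + (18 * r%:R ^+ 2)^-1 &
    forall x, a' <= x <= a' + (18 * (3 * r)%:R ^+ 2)^-1 -> x != y /\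
      forall (t : nat) (b : int), (0 < t < 3 * r)%N ->
        (512 * r%:R ^+ 2)^-1 <= `|x - b%:~R / t%:R| ].
Proof.
move=> r0; have rR : 0 < r%:R :> R by rewrite ltr0n.
set i := (r%:R ^+ 2)^-1 : R.
have i0 : 0 < i by rewrite invr_gt0 exprn_gt0.
have -> : (18 * (3 * r)%:R ^+ 2)^-1 = i / 162 :> R.
  by rewrite natrM /i; field; rewrite gt_eqF.
have -> : (18 * r%:R ^+ 2)^-1 = 9 * (i / 162) :> R by rewrite /i; field; rewrite gt_eqF.
have -> : (512 * r%:R ^+ 2)^-1 = i / 512 :> R by rewrite /i; field; rewrite gt_eqF.
pose near_cell (v : R) := a - i / 512 < v < a + 9 * (i / 162) + i / 512.
have [v hv] : exists v : R, forall (t : nat) (b : int), (0 < t < 3 * r)%N ->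
    near_cell (b%:~R / t%:R) -> b%:~R / t%:R = v.
  have [[t0 [b0 [ht0 hn0]]]|none] := pselect (exists (t : nat) (b : int),
      (0 < t < 3 * r)%N /\ near_cell (b%:~R / t%:R)); last first.
    (* No fraction is near the cell here, so the value of [v] is arbitrary. *)
    by exists 0 => t b ht hn; case: none; exists t, b.
  exists (b0%:~R / t0%:R) => t b ht hn; apply/eqP/contraT => ne.
  have /andP[tp tr] := ht; have /andP[tp0 tr0] := ht0.
  have := dist_fractions tp tp0 ne.
  have : i / 9 <= (t%:R * t0%:R)^-1.
    have -> : i / 9 = (3 * r%:R * (3 * r%:R))^-1 by rewrite /i; field; rewrite gt_eqF.
    rewrite lef_pV2 ?posrE ?mulr_gt0 ?ltr0n//.
    by rewrite -!natrM ler_nat leq_mul// ltnW.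
  move=> h1 h2; have := le_trans h1 h2.
  move: hn hn0; rewrite /near_cell; move: (b%:~R / _) (b0%:~R / _) => f f0 hn hn0.
  by rewrite leNgt => /negP; case; rewrite ltr_norml; apply/andP; split; lra.
have [|//|a' [h1 h2 h3]] := @three_pieces R a (i / 162) (i / 512) v y; first by lra.
  by lra.
exists a'; split => // x hx; have [xy xv] := h3 x hx; split => // t b ht.
have [/(hv _ _ ht) ->//|] := boolP (near_cell (b%:~R / t%:R)).
rewrite /near_cell negb_and -!leNgt => /orP[] h.
  by apply: le_trans (ler_norm _); lra.
by rewrite distrC; apply: le_trans (ler_norm _); lra.
Qed.

(** * Dirichlet approximation *)

Lemma dirichlet_approx (R : realType) (z : R) (Q : nat) : (0 < Q)%N ->
  exists (q : nat) (p : int), (0 < q <= Q)%N /\ `|q%:R * z - p%:~R| <= Q%:R^-1.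
Proof.
move=> Q0; have QR : 0 < Q%:R :> R by rewrite ltr0n.
pose fr (i : nat) : R := i%:R * z - (Num.floor (i%:R * z))%:~R.
have fr0 i : 0 <= fr i by rewrite subr_ge0 floor_le.
have fr1 i : fr i < 1 by rewrite ltrBlDl; have := floorD1_gt (i%:R * z); rewrite intrD1.
have box i : (Num.truncn (Q%:R * fr i) < Q)%N.
  rewrite -(ltr_nat R); apply: le_lt_trans (_ : Q%:R * fr i < _).
    by rewrite truncn_le// mulr_ge0// ltW.
  by rewrite gtr_pMr.
(* Pigeonhole: the [Q + 1] fractional parts of [i z], [0 <= i <= Q], fall into [Q] boxes of length
   [1 / Q]. *)
have /injectivePn[i [j ij eij]] : ~~ injectiveb (fun i : 'I_Q.+1 => Ordinal (box i)).
  by apply/negP => /injectiveP /leq_card; rewrite !card_ord ltnn.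
have {eij} eT : Num.truncn (Q%:R * fr i) = Num.truncn (Q%:R * fr j) by case: eij.
have close : `|fr i - fr j| < Q%:R^-1.
  rewrite -(ltr_pM2l QR) divff ?gt_eqF// -{1}(gtr0_norm QR) -normrM mulrBr.
  have /andP[] := truncn_itv (mulr_ge0 (ltW QR) (fr0 i)).
  have /andP[] := truncn_itv (mulr_ge0 (ltW QR) (fr0 j)).
  rewrite eT -natr1; set n := Num.truncn _; move=> h1 h2 h3 h4.
  by rewrite ltr_norml; apply/andP; split; lra.
wlog ltij : i j ij eT close / (j < i)%N.
  move=> wl; have [ji|ji|] := ltngtP i j; last by move/val_inj/eqP; rewrite (negPf ij).
  - by apply: (wl j i); rewrite // 1?eq_sym// distrC.
  - exact: (wl i j).
exists (i - j)%N, (Num.floor (i%:R * z) - Num.floor (j%:R * z)); split.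
  by have := ltn_ord i; lia.
rewrite natrB 1?ltnW// intrB; apply: le_trans (ltW close).
by rewrite /fr le_eqVlt; apply/orP; left; apply/eqP; congr `|_|; ring.
Qed.

(* Minimality of [q] replaces coprimality of [p] and [q]. *)
Lemma dirichlet_minimal (R : realType) (z : R) (Q : nat) : (0 < Q)%N ->
  exists (q : nat) (p : int), [/\ (0 < q <= Q)%N,
    `|z - p%:~R / q%:R| <= (q%:R * Q%:R)^-1 &
    forall (t : nat) (b : int), (0 < t < q)%N ->
      p%:~R / q%:R != b%:~R / t%:R :> R].
Proof.
move=> Q0; have QR : 0 < Q%:R :> R by rewrite ltr0n.
pose P q := (0 < q)%N && `[< exists p : int, `|q%:R * z - p%:~R| <= Q%:R^-1 >].
have [q1 [p1 [/andP[q1p q1Q] hp1]]] := dirichlet_approx z Q0.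
have exP : exists q, P q.
  by exists q1; rewrite /P q1p /=; apply/asboolP; exists p1.
case: (ex_minnP exP) => q /andP[q0 /asboolP[p hp]] qmin.
have qR : 0 < q%:R :> R by rewrite ltr0n.
exists q, p; split.
- rewrite q0 (leq_trans _ q1Q)// qmin// /P q1p /=; apply/asboolP; exists p1.
  exact: hp1.
- rewrite invfM -(ler_pM2l qR) mulrA divff ?gt_eqF// mul1r.
  rewrite -{1}(gtr0_norm qR) -normrM; suff -> : q%:R * (z - p%:~R / q%:R) = q%:R * z - p%:~R by [].
  by field; rewrite gt_eqF.
- move=> t b /andP[t0 tq]; apply/negP => /eqP e.
  have tR : 0 < t%:R :> R by rewrite ltr0n.
  suff /qmin : P t by rewrite leqNgt tq.
  rewrite /P t0 /=; apply/asboolP; exists b.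
  (* If [p / q = b / t], the error for [t] is [t / q] times the error for [q], so [t < q]
     contradicts minimality. *)
  have -> : t%:R * z - b%:~R = t%:R / q%:R * (q%:R * z - p%:~R).
    transitivity (t%:R * (z - b%:~R / t%:R)); first by field; rewrite gt_eqF.
    by rewrite -e; field; rewrite gt_eqF.
  rewrite normrM gtr0_norm ?divr_gt0//; apply: le_trans hp.
  by rewrite ler_piMl// ler_pdivrMr// mul1r ler_nat ltnW.
Qed.

(** * Distance from fractions to points near [p / q + 1 / (q^2 m)] *)

Definition well_separated (R : realFieldType) (p : int) (q : nat) (g : R) : Prop :=
  forall (t : nat) (b : int), (0 < t < q)%N ->
    g / t%:R ^+ 2 <= `|p%:~R / q%:R - b%:~R / t%:R|.

(* With [s = b q - p t] and [u = t - q m s], the distance from [b / t] to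
   [p / q + 1 / (q^2 m)] is [|u| / (t q^2 m)]. *)
Lemma numerator_lower (R : realFieldType) (p b : int) (q m t : nat) (f : R) :
  (0 < q)%N -> (0 < t)%N -> (4 <= m)%N -> (q <= 192 * t)%N ->
  0 <= f -> f <= 1 / 1000 -> ((q <= t)%N -> f * m%:R <= 1) ->
  well_separated p q (4 / m%:R : R) ->
  b * q%:Z != p * t%:Z ->
  let u := t%:Z - q%:Z * m%:Z * (b * q%:Z - p * t%:Z) in
  u != 0 -> (q ^ 2 * m)%:R * f <= 2 / 3 * t%:R * `|u|%:~R.
Proof.
move=> q0 t0 m4 qt f0 f1 fm good ne u un0.
have qR : 0 < q%:R :> R by rewrite ltr0n.
have tR : 0 < t%:R :> R by rewrite ltr0n.
have mR : 4 <= m%:R :> R by rewrite ler_nat.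
have qtR : q%:R <= 192 * t%:R :> R by rewrite -natrM ler_nat.
have u1 : 1 <= `|u|%:~R :> R by rewrite ler1z -gtz0_ge1 normr_gt0.
set s := b * q%:Z - p * t%:Z in u un0 u1 *.
have s1 : 1 <= `|s| by rewrite -gtz0_ge1 normr_gt0 subr_eq0.
set U : R := `|u|%:~R in u1 *.
pose S : R := `|s|%:~R.
have S1 : 1 <= S by rewrite ler1z.
have US : q%:R * m%:R * S <= U + t%:R.
  have : q%:Z * m%:Z * `|s| <= `|u| + t%:Z.
    have -> : q%:Z * m%:Z * `|s| = `|t%:Z - u|.
      by rewrite -[q%:Z * m%:Z]ger0_norm// -normrM; congr `|_|; rewrite /u; ring.
    by rewrite [leRHS]addrC; apply: le_trans (ler_normB _ _) _; rewrite ger0_norm.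
  by rewrite -(ler_int R) intrD !intrM -!pmulrn.
have SU : q%:R * m%:R * S <= t%:R + U by lra.
have mS : q%:R * m%:R <= q%:R * m%:R * S by rewrite ler_peMr// mulr_ge0 ?ler0n.
rewrite natrM natrX.
(* For [q^2 m <= t] the bound [f <= 1 / 1000] suffices. For [t < q], [|u|] is at least [q m / 2],
   and [q <= 192 t] bounds [q f] by a small multiple of [t]. *)
have [Nt|tN] := leqP (q ^ 2 * m) t.
  have : q%:R ^+ 2 * m%:R <= t%:R :> R by rewrite -natrX -natrM ler_nat.
  move: (q%:R ^+ 2 * m%:R) => N Nt'.
  have : N * f <= t%:R * f by rewrite ler_wpM2r.
  by nra.
have [qlet|tltq] := leqP q t; last first.
  have tq : t%:R < q%:R :> R by rewrite ltr_nat.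
  have h : q%:R * m%:R <= 2 * U by nra.
  have h1 : q%:R * f <= 192 / 1000 * t%:R by nra.
  have : q%:R ^+ 2 * m%:R * f = (q%:R * m%:R) * (q%:R * f) by ring.
  have : (q%:R * m%:R) * (q%:R * f) <= (2 * U) * (192 / 1000 * t%:R).
    by apply: ler_pM => //; rewrite mulr_ge0// ?ltW//; lra.
  have : 0 <= t%:R * U by rewrite mulr_ge0//; lra.
  by nra.
have tq : q%:R <= t%:R :> R by rewrite ler_nat.
have : q%:R ^+ 2 * m%:R * f <= q%:R ^+ 2.
  rewrite -mulrA; apply: ler_piMr; first by rewrite exprn_ge0// ltW.
  by rewrite mulrC fm.
(* If [t < 2 q], then [q m |s| <= t + |u|] forces [|u| >= 2 q]. If [t >= 2 q], either of [q <= |u|]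
   and [t <= 2 |u|] is enough. Only a small [|u|] calls for the separation of [p / q]. *)
suff : q%:R ^+ 2 <= 2 / 3 * t%:R * U by lra.
have [t2q|t2q] := ltP t%:R (2 * q%:R : R).
  have : 2 * q%:R <= U by nra.
  by nra.
have [Uq|Uq] := leP q%:R U; first by nra.
have [Ut|Ut] := leP t%:R (2 * U); first by nra.
(* Separation applies to the denominator [|u| < q], because
   [p u = q (b - p m s) - s]. *)
have uq : (0 < `|u| < q)%N.
  by rewrite absz_gt0 un0 /= -ltz_nat -(ltr_int R) abszE.
have eU : `|u|%N%:R = U :> R by rewrite /U -abszE pmulrn.
(* The sign of [u] turns the fraction [(b - p m s) / u] into one with positive denominator [|u|]; it
   differs from [p / q] by [|s| / (q |u|)]. *)
have [sg hsg] : exists sg : int, u = sg * `|u|%N /\ (`|sg| = 1 /\ sg * sg = 1).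
  by exists (Num.sg u); rewrite -numEsg normr_sg -expr2 sqr_sg un0.
have /= := good `|u|%N (sg * (b - p * m%:Z * s)) uq.
rewrite eU.
have -> : `|p%:~R / q%:R - (sg * (b - p * m%:Z * s))%:~R / U| = S / (q%:R * U) :> R.
  case: hsg => eu [sg1 sgsg].
  have euR : sg%:~R * U = u%:~R :> R by rewrite -eU pmulrn -intrM -eu.
  have U0 : U != 0 by apply: lt0r_neq0; lra.
  have -> : p%:~R / q%:R - (sg * (b - p * m%:Z * s))%:~R / U =
     (sg * (p * u - q%:Z * (b - p * m%:Z * s)))%:~R / (q%:R * U) :> R.
    rewrite !intrM !intrB !intrM -!pmulrn -euR.
    have : sg%:~R * sg%:~R = 1 :> R by rewrite -intrM sgsg.
    move: (sg%:~R : R) => g gg; apply: (@mulIf _ (q%:R * U)).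
      by rewrite mulf_neq0// gt_eqF.
    rewrite [RHS]mulfVK ?mulf_neq0 ?gt_eqF//; last lra.
    transitivity (p%:~R * U - q%:R * (g * (b%:~R - p%:~R * m%:R * s%:~R))).
      by field; rewrite U0 gt_eqF.
    transitivity (g * g * (p%:~R * U) - q%:R * (g * (b%:~R - p%:~R * m%:R * s%:~R))).
      by rewrite gg mul1r.
    by ring.
  have -> : p * u - q%:Z * (b - p * m%:Z * s) = - s by rewrite /u /s; ring.
  rewrite normrM normfV [`|q%:R * U|]gtr0_norm ?mulr_gt0//; last lra.
  by rewrite -intr_norm normrM sg1 mul1r normrN.
rewrite ler_pdivlMr ?mulr_gt0//; last lra.
have -> : 4 / m%:R / U ^+ 2 * (q%:R * U) = 4 * q%:R / (m%:R * U) :> R.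
  by field; apply/andP; split; rewrite gt_eqF//; lra.
rewrite ler_pdivrMr; last by rewrite mulr_gt0//; lra.
move=> h.
have : q%:R * (4 * q%:R) <= q%:R * (S * (m%:R * U)) by rewrite ler_pM2l.
have : (q%:R * m%:R * S) * U <= (t%:R + U) * U by rewrite ler_wpM2r//; lra.
by nra.
Qed.

(** Over the denominator [t N], with [N = q^2 m], the difference has numerator [u - t N th]. If [u]
    is nonzero, the shift [t N th <= 1 / 3] removes at most a third of [|u|], and [numerator_lower]
    needs only the other two thirds. If [u = 0], then [b / t] equals [p / q + 1 / N] and [th] itself
    is the distance. *)
Lemma dist_near_new_fraction (R : realFieldType) (p b : int) (q m t : nat) (f th : R) :
  (0 < q)%N -> (0 < t)%N -> (4 <= m)%N -> (q <= 192 * t)%N ->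
  0 <= f -> f <= 1 / 1000 -> ((q <= t)%N -> f * m%:R <= 1) ->
  well_separated p q (4 / m%:R : R) ->
  b * q%:Z != p * t%:Z ->
  0 <= th -> 3 * t%:R * (q ^ 2 * m)%:R * th <= 1 ->
  ((q ^ 2 * m <= t)%N -> f <= t%:R ^+ 2 * th) ->
  f / t%:R ^+ 2 <= `|p%:~R / q%:R + (q ^ 2 * m)%:R^-1 - th - b%:~R / t%:R|.
Proof.
move=> q0 t0 m4 qt f0 f1 fm good ne th0 th1 thN.
have qR : 0 < q%:R :> R by rewrite ltr0n.
have tR : 0 < t%:R :> R by rewrite ltr0n.
have mR : 0 < m%:R :> R by rewrite ltr0n (leq_trans _ m4).
have := numerator_lower q0 t0 m4 qt f0 f1 fm good ne.
set s := b * q%:Z - p * t%:Z; set u := t%:Z - _ => /= num.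
have NR : 0 < (q ^ 2 * m)%:R :> R by rewrite natrM natrX mulr_gt0 ?exprn_gt0.
have -> : p%:~R / q%:R + (q ^ 2 * m)%:R^-1 - th - b%:~R / t%:R =
    (u%:~R - t%:R * (q ^ 2 * m)%:R * th) / (t%:R * (q ^ 2 * m)%:R) :> R.
  rewrite /u /s intrB !intrM intrB !intrM -!pmulrn natrM natrX; field.
  by rewrite !gt_eqF.
rewrite normrM normfV [`|t%:R * _|]gtr0_norm ?mulr_gt0//.
rewrite ler_pdivlMr ?mulr_gt0//.
set N : R := (q ^ 2 * m)%:R in th1 NR num *.
have -> : f / t%:R ^+ 2 * (t%:R * N) = N * f / t%:R by field; rewrite gt_eqF.
rewrite ler_pdivrMr// [leRHS]mulrC.
have tNth : 0 <= t%:R * N * th by rewrite !mulr_ge0// ltW.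
have [u0|un0] := eqVneq u 0; last first.
  apply: le_trans (num un0) _; rewrite -mulrA mulrCA ler_pM2l//.
  have u1 : 1 <= `|u|%:~R :> R by rewrite ler1z -gtz0_ge1 normr_gt0.
  rewrite intr_norm in u1 *.
  have := lerB_dist (u%:~R) (t%:R * N * th).
  by rewrite [`|t%:R * N * th|]ger0_norm//; lra.
rewrite u0 sub0r normrN ger0_norm//.
have Nt : (q ^ 2 * m <= t)%N.
  (* Substituting [t = q m s] in [s = b q - p t] shows that [q] divides [s], hence [q^2 m] divides
     [t]. *)
  have tE : t%:Z = q%:Z * m%:Z * s by apply/eqP; rewrite -subr_eq0 -/u u0.
  have [j sj] : exists j : int, s = q%:Z * j.
    by exists (b - p * m%:Z * s); rewrite {1}/s tE; ring.
  have tj : t%:Z = (q ^ 2 * m)%N%:Z * j.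
    by rewrite tE sj PoszM expnS expn1 PoszM; ring.
  have j0 : 0 < j.
    have N0 : 0 < (q ^ 2 * m)%N%:Z by rewrite ltz_nat muln_gt0 expn_gt0 q0 (leq_trans _ m4).
    by rewrite -(pmulr_rgt0 _ N0) -tj ltz_nat.
  by rewrite -lez_nat tj; apply: ler_peMr; rewrite // -gtz0_ge1.
have -> : t%:R * (t%:R * N * th) = N * (t%:R ^+ 2 * th) by ring.
by rewrite ler_pM2l// thN.
Qed.

(** * Cells and their refinement *)

Definition cell (R : realFieldType) (a : R) (r : nat) : set R :=
  [set x | a <= x <= a + (18 * r%:R ^+ 2)^-1].

(** Each round triples the scale. A denominator [t] is treated in the round of scale [r1] with
    [r1 <= t < 3 r1], where the gap [1 / (512 r1^2)] is at least [1 / (512 t^2)]. *)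
Lemma refine_away (R : realFieldType) (a y : R) (r k : nat) : (0 < r)%N ->
  exists a', forall x, cell a' (3 ^ k * r) x -> [/\ cell a r x,
    (0 < k)%N -> x != y &
    forall (t : nat) (b : int), (r <= t < 3 ^ k * r)%N ->
      1 / 512 / t%:R ^+ 2 <= `|x - b%:~R / t%:R| ].
Proof.
move=> r0; elim: k => [|k [a1 IH]].
  by exists a => x; rewrite mul1n; split=> // t b /andP[]; lia.
set r1 := (3 ^ k * r)%N in IH.
have r10 : (0 < r1)%N by rewrite muln_gt0 expn_gt0.
have [a' [h1 h2 h3]] := subcell_away a1 y r10.
have -> : (3 ^ k.+1 * r = 3 * r1)%N by rewrite expnS /r1 mulnA.
exists a' => x hx; have [xy xf] := h3 x hx.
have x1 : cell a1 r1 x.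
  by move: hx => /andP[hx1 hx2]; apply/andP; split; [exact: le_trans hx1|exact: le_trans h2].
have [xr _ xg] := IH x x1; split => // t b /andP[rt t3].
have [tr1|r1t] := ltnP t r1; first by apply: xg; rewrite rt.
apply: le_trans (xf t b _); last by rewrite t3 andbT; lia.
have tR : 0 < t%:R :> R by rewrite ltr0n; lia.
have rR : 0 < r1%:R :> R by rewrite ltr0n.
have inv_le (c u v : R) : 0 < c -> 0 < v -> v <= u -> 1 / c / u <= (c * v)^-1.
  move=> c0 v0 vu; rewrite div1r invfM; apply: ler_wpM2l; first by rewrite invr_ge0 ltW.
  by rewrite lef_pV2 ?posrE// (lt_le_trans v0).
apply: inv_le; [by rewrite ltr0n|exact: exprn_gt0|].
by rewrite ler_pXn2r ?nnegrE ?ler_nat// ltW.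
Qed.

(** Dirichlet's theorem at the midpoint of a refined cell gives [p / q]. The gaps at the midpoint
    keep [q] from being small, so [p / q] lies in the middle half of the cell and inherits the gaps
    of its points. *)
Lemma refine_separated (R : realType) (a y d g : R) (r K : nat) :
  (0 < r)%N -> 0 < d -> g <= d -> g <= 1 / 512 ->
  (forall x (t : nat) (b : int), cell a r x -> (0 < t < r)%N ->
     d / t%:R ^+ 2 <= `|x - b%:~R / t%:R|) ->
  exists (a' : R) (r' q : nat) (p : int),
   [/\ (K <= r')%N /\ (3 * r' <= 8 * q)%N, (q <= 192 * r')%N,
    well_separated p q g,
    a' + (72 * r'%:R ^+ 2)^-1 <= p%:~R / q%:R <= a' + 3 * (72 * r'%:R ^+ 2)^-1 &
    forall x, cell a' r' x -> [/\ cell a r x, x != y &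
      forall (t : nat) (b : int), (r <= t < r')%N ->
        1 / 512 / t%:R ^+ 2 <= `|x - b%:~R / t%:R| ]].
Proof.
move=> r0 d0 gd g1 gap.
have rR : 0 < r%:R :> R by rewrite ltr0n.
(* With [k >= 1 / d] the new scale exceeds [r / d], so that even the old gap [d / q^2] contradicts
   Dirichlet's bound when [q < r]. *)
have [k [k0 Kk dk]] : exists k, [/\ (0 < k)%N, (K <= k)%N & d^-1 <= k%:R].
  exists (K + (Num.truncn d^-1).+1)%N; split; rewrite ?addnS ?ltnS ?leq0n//.
    by rewrite -addnS leq_addr.
  apply: le_trans (ltW (truncnS_gt _)) _.
  by rewrite ler_nat -addnS leq_addl.
have k3 : (k < 3 ^ k)%N by apply: ltn_expl.
have [a' ha'] := refine_away a y k r0.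
have kr' : (k <= 3 ^ k * r)%N by rewrite (leq_trans (ltnW k3))// leq_pmulr.
have rkr' : (r * k <= 3 ^ k * r)%N by rewrite mulnC leq_mul2r ltnW ?orbT.
move: (3 ^ k * r)%N => r' in ha' kr' rkr'.
have r'0 : (0 < r')%N by rewrite (leq_trans k0).
have r'R : 0 < r'%:R :> R by rewrite ltr0n.
have dr : r%:R < d * (192 * r'%:R).
  move: dk; rewrite -(ler_pM2l d0) divff ?gt_eqF// => dk.
  have : r%:R * k%:R <= r'%:R :> R by rewrite -natrM ler_nat.
  have : d * (r%:R * k%:R) = r%:R * (d * k%:R) by ring.
  by nra.
pose l : R := (72 * r'%:R ^+ 2)^-1.
have l0 : 0 < l by rewrite invr_gt0; apply: mulr_gt0 => //; rewrite exprn_gt0.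
have cellE x : cell a' r' x = (a' <= x <= a' + 4 * l) :> Prop.
  rewrite /cell /=; suff -> : (18 * r'%:R ^+ 2)^-1 = 4 * l by [].
  by rewrite /l; field; rewrite gt_eqF.
have zin : cell a' r' (a' + 2 * l) by rewrite cellE; lra.
have Q0 : (0 < 192 * r')%N by rewrite muln_gt0.
have [q [p [/andP[q0 qQ] hz qmin]]] := dirichlet_minimal (a' + 2 * l) Q0.
have qR : 0 < q%:R :> R by rewrite ltr0n.
(* Dirichlet's bound [1 / (192 q r')] is below the gap [1 / (512 q^2)] exactly when [8 q < 3 r']. *)
have q38 : (3 * r' <= 8 * q)%N.
  rewrite leqNgt; apply/negP => lt.
  have [zr _ zg] := ha' _ zin.
  have Q0' : 0 < q%:R * (192 * r'%:R) :> R by rewrite -natrM; apply: mulr_gt0; rewrite // ltr0n.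
  have := hz; rewrite natrM -[leRHS]div1r ler_pdivlMr// leNgt => /negP; apply.
  have [qr|rq] := ltnP q r.
    have := gap _ q p zr; rewrite q0 qr => /(_ isT).
    rewrite ler_pdivrMr ?exprn_gt0//; set A := `|_| => hA.
    have qr' : q%:R < r%:R :> R by rewrite ltr_nat.
    have : d * (192 * r'%:R) <= A * q%:R ^+ 2 * (192 * r'%:R).
      by rewrite ler_wpM2r// mulr_ge0// ltW.
    have -> : A * q%:R ^+ 2 * (192 * r'%:R) = q%:R * (A * (q%:R * (192 * r'%:R))) by ring.
    move: (A * _) => B hB.
    by rewrite -(ltr_pM2l qR); lra.
  have qr' : (r <= q < r')%N by rewrite rq /=; move: lt; clear; lia.
  have := zg q p qr'.
  rewrite ler_pdivrMr ?exprn_gt0//; set A := `|_| => hA.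
  have lt' : 8 * q%:R < 3 * r'%:R :> R by rewrite -!natrM ltr_nat.
  have : 1 / 512 * (192 * r'%:R) <= A * q%:R ^+ 2 * (192 * r'%:R).
    by rewrite ler_wpM2r// mulr_ge0// ltW.
  have -> : A * q%:R ^+ 2 * (192 * r'%:R) = q%:R * (A * (q%:R * (192 * r'%:R))) by ring.
  move: (A * _) => B hB.
  by rewrite -(ltr_pM2l qR); lra.
(* Since [192 * 3 / 8 = 72], Dirichlet's bound is at most [l], a quarter of the cell. *)
have pq : a' + l <= p%:~R / q%:R <= a' + 3 * l.
  have : `|a' + 2 * l - p%:~R / q%:R| <= l.
    apply: le_trans hz _; have r2 : 0 < 72 * r'%:R ^+ 2 :> R by rewrite -invr_gt0.
    have qQ0 : 0 < q%:R * (192 * r')%:R :> R by apply: mulr_gt0; rewrite // ltr0n.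
    rewrite lef_pV2 ?posrE//.
    have : 3 * r'%:R <= 8 * q%:R :> R by rewrite -!natrM ler_nat.
    by rewrite natrM; nra.
  by rewrite ler_norml; lra.
have pqin : cell a' r' (p%:~R / q%:R) by rewrite cellE; lra.
exists a', r', q, p; split=> //.
- by split; [exact: leq_trans kr'|exact: q38].
- move=> t b /andP[t0 tq]; have [pr _ pg] := ha' _ pqin.
  have tR : 0 < t%:R :> R by rewrite ltr0n.
  have t2 : 0 <= (t%:R ^+ 2)^-1 :> R by rewrite invr_ge0 exprn_ge0// ltW.
  have [tr|rt] := ltnP t r.
    by apply: le_trans (gap _ t b pr _); rewrite ?t0// ler_wpM2r.
  have [tr'|r't] := ltnP t r'.
    by apply: le_trans (pg t b _); rewrite ?rt// ler_wpM2r.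
  (* For [r' <= t < q] the two fractions differ by at least [1 / (q t)], and
     [q <= 192 r' <= 192 t]. *)
  apply: le_trans (dist_fractions q0 t0 (qmin t b _)); last by rewrite t0.
  apply: le_trans (_ : 1 / 192 / t%:R ^+ 2 <= _).
    by rewrite ler_wpM2r//; lra.
  have -> : 1 / 192 / t%:R ^+ 2 = (192 * t%:R * t%:R)^-1 :> R by field; rewrite gt_eqF.
  have t192 : 0 < 192 * t%:R :> R by move: tR; clear; lra.
  rewrite lef_pV2 ?posrE; [|exact: mulr_gt0|exact: mulr_gt0].
  apply: ler_wpM2r; first exact: ltW.
  by rewrite -natrM ler_nat; move: qQ r't; clear; lia.
- by move=> x hx; have [xr xy xg] := ha' x hx; split => //; apply: xy.
Qed.

(** * One step of the nested construction *)

Lemma finite_pos_lower_bound (R : realDomainType) (h : nat -> R) (n : nat) :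
  (forall t, (0 < t)%N -> 0 < h t) ->
  exists2 d, 0 < d & forall t, (0 < t < n)%N -> d <= h t.
Proof.
move=> h0; elim: n => [|n [d d0 hd]]; first by exists 1 => // t; rewrite andbF.
have [->|n0] := posnP n; first by exists 1 => // t; lia.
exists (Num.min d (h n)); first by rewrite lt_min d0 h0.
move=> t /andP[t0]; rewrite ltnS leq_eqVlt => /predU1P[->|tn].
  by rewrite ge_min lexx orbT.
by rewrite ge_min hd ?t0.
Qed.

(** The gap [d / t^2] is what the next refinement starts from; the second bound is the one demanded
    by [E]. *)
Definition clears (R : realFieldType) (Psi omega : R -> R) (T : nat) (a : R) (r : nat) (d : R) :=
  forall x (t : nat) (b : int), cell a r x -> (0 < t < r)%N ->
    d / t%:R ^+ 2 <= `|x - b%:~R / t%:R| /\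
    ((T <= t)%N -> (1 - omega t%:R) * Psi t%:R <= `|x - b%:~R / t%:R|).

Lemma square_divisibilityP (R : realType) (Psi : R -> R) (q : nat) :
  (forall q : R, 0 < q -> 0 < Psi q) -> square_divisibility Psi -> (0 < q)%N ->
  exists2 m : nat, (0 < m)%N & Psi q%:R = (q ^ 2 * m)%:R^-1.
Proof.
move=> Psi_pos sq q0; have [n eN /dvdzP[k ek]] := sq q q0.
have P0 : 0 < Psi q%:R by apply: Psi_pos; rewrite ltr0n.
have n0 : 0 < n by rewrite -(ltr0z R) -eN invr_gt0.
have k0 : 0 < k.
  by move: n0; rewrite ek pmulr_lgt0// ltz_nat expn_gt0 q0.
exists `|k|%N; first by lia.
apply: invr_inj; rewrite invrK eN ek mulnC PoszM /= -[in LHS](gtz0_abs k0).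
by rewrite -PoszM pmulrn.
Qed.

(** Denominators below [r] are handled by the old cell, those from [r] to [r1] by the refinement,
    those from [r1] to [r'] by [dist_near_new_fraction]. Fractions equal to [p / q] are treated
    apart, through the distance [1 / N - L] kept from [p / q]. *)
Lemma clears_step (R : realType) (Psi omega : R -> R) (T : nat)
  (Psi_pos : forall q : R, 0 < q -> 0 < Psi q)
  (omega_01 : forall q : R, 0 < q -> 0 < omega q < 1)
  (small : forall e : R, 0 < e -> exists M : nat, forall q : R,
     M%:R <= q -> q ^+ 2 * Psi q <= e)
  (Psi_noninc : forall q r : R, 0 < q -> q <= r ->
     r ^+ 2 * Psi r <= q ^+ 2 * Psi q)
  (Psi_sqdiv : square_divisibility Psi)
  (small_T : forall q : R, T%:R <= q -> q ^+ 2 * Psi q <= 1 / 1000)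
  (big : forall q : nat, (T <= q)%N ->
     45 / (16 * Psi q%:R) * Psi (1 / (8 * Psi q%:R)) <= omega q%:R)
  (a y d : R) (r K : nat) :
  (0 < r)%N -> 0 < d -> clears Psi omega T a r d ->
  exists (a' d' : R) (r' : nat), [/\ (0 < r')%N /\ 0 < d', (K <= r')%N,
    clears Psi omega T a' r' d',
    forall x, cell a' r' x -> cell a r x /\ x != y &
    exists (q : nat) (p : int), [/\ (0 < q)%N, (K <= q)%N &
      forall x, cell a' r' x -> `|x - p%:~R / q%:R| <= Psi q%:R]].
Proof.
move=> r0 d0 clr.
pose g := Num.min d (1 / 512).
have g0 : 0 < g by rewrite lt_min d0; lra.
have g4 : 0 < g / 4 by lra.
have [M hM] := small _ g4.
have gd : g <= d by rewrite ge_min lexx.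
have g1 : g <= 1 / 512 by rewrite ge_min lexx orbT.
(* The factor 4 outweighs the loss in [8 q >= 3 r1], so [q] too exceeds [M], [K] and [T]. *)
have [x t b xr tr|a1 [r1 [q [p [[Kr1 r1q] qr1 sep pq ha1]]]]] :=
  @refine_separated R a y d g r (4 * (M + K + T + r + 1)) r0 d0 gd g1.
  by have [] := clr x t b xr tr.
have q0 : (0 < q)%N by move: Kr1 r1q; clear; lia.
have r10 : (0 < r1)%N by move: Kr1; clear; lia.
have qR : 0 < q%:R :> R by rewrite ltr0n.
have r1R : 0 < r1%:R :> R by rewrite ltr0n.
have [m m0 ePsi] := square_divisibilityP Psi_pos Psi_sqdiv q0.
pose N : R := (q ^ 2 * m)%:R.
have N0 : 0 < N by rewrite ltr0n muln_gt0 expn_gt0 q0.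
have mR : 0 < m%:R :> R by rewrite ltr0n.
have NN : (q ^ 2 * m)%:R = N by [].
have NE : N = q%:R ^+ 2 * m%:R by rewrite /N natrM natrX.
rewrite NN in ePsi; clearbody N.
have fq : q%:R ^+ 2 * Psi q%:R = m%:R^-1.
  by rewrite ePsi NE; field; rewrite !gt_eqF.
have TqR : T%:R <= q%:R :> R by rewrite ler_nat; move: Kr1 r1q; clear; lia.
have m1000 : 1000 <= m%:R :> R.
  have := small_T _ TqR; rewrite fq -[m%:R^-1]div1r ler_pdivrMr//; lra.
have mg : 4 / m%:R <= g.
  have : q%:R ^+ 2 * Psi q%:R <= g / 4 by apply: hM; rewrite ler_nat; move: Kr1 r1q; clear; lia.
  by rewrite fq; clear; lra.
have m4 : (4 <= m)%N by rewrite -(ler_nat R); lra.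
have sep4 : well_separated p q (4 / m%:R : R).
  move=> t b tq; apply: le_trans (sep t b tq).
  by rewrite ler_wpM2r// invr_ge0 exprn_ge0// ler0n.
have qN : 8 * q%:R <= N.
  have q1 : 1 <= q%:R :> R by rewrite ler1n.
  have : q%:R <= q%:R ^+ 2 :> R by rewrite expr2; move: q1; clear; nra.
  by rewrite NE; move: qR m1000; clear; nra.
have [f8 f8E] : exists z, z = (N / 8) ^+ 2 * Psi (N / 8) by eexists.
have f80 : 0 < f8 by rewrite f8E mulr_gt0 ?exprn_gt0 ?Psi_pos ?divr_gt0.
have f81 : f8 <= 1 / 1000 by rewrite f8E; apply: small_T; move: TqR qN qR; clear; lra.
(* [180 = 45 / 16 * 64], where 64 comes from [(N / 8)^2]. *)
have [lam lamE] : exists z, z = 180 * f8 by eexists.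
have [L LE] : exists z, z = lam / N ^+ 2 by eexists.
have lam0 : 0 < lam by rewrite lamE; move: f80; clear; lra.
have lam1 : lam <= 1 / 5 by rewrite lamE; move: f81; clear; lra.
have N2 : 0 < N ^+ 2 by rewrite exprn_gt0.
have L0 : 0 < L by rewrite LE divr_gt0.
have iN0 : 0 < N^-1 by rewrite invr_gt0.
have iN1 : N^-1 <= 1.
  rewrite invf_le1//; have : 1 <= q%:R :> R by rewrite ler1n.
  by move: qN; clear; lra.
have LN : L <= lam * N^-1.
  rewrite LE expr2 invfM; apply: ler_wpM2l; first exact: ltW.
  by move: iN0 iN1; clear; nra.
have Lom : L <= omega q%:R * N^-1.
  have Tq : (T <= q)%N by move: Kr1 r1q; clear; lia.
  have := big q Tq; rewrite ePsi.
  have -> : 1 / (8 * N^-1) = N / 8 by field; rewrite gt_eqF.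
  have -> : Psi (N / 8) = 64 * f8 / N ^+ 2 by rewrite f8E; field; rewrite gt_eqF.
  have -> : 45 / (16 * N^-1) * (64 * f8 / N ^+ 2) = N * L.
    by rewrite LE lamE; field; rewrite gt_eqF.
  by move=> h; rewrite -(ler_pM2l N0) [leRHS]mulrCA divff ?gt_eqF// mulr1.
(* [t <= Y] is equivalent to [3 t N L <= 1], the limit on the shift in [dist_near_new_fraction]. *)
have [Y YE] : exists z, z = N / (3 * lam) by eexists.
pose r' := (Num.truncn Y).+1.
have lam3 : 0 < 3 * lam by move: lam0; clear; lra.
have Y0 : 0 < Y by rewrite YE divr_gt0.
have Yr' : Y < r'%:R by apply: truncnS_gt.
have r'Y t : (t < r')%N -> t%:R <= Y.
  rewrite ltnS -(ler_nat R) => h; apply: le_trans h _.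
  by rewrite truncn_le// ltW.
have NY : N <= Y.
  rewrite YE ler_pdivlMr//; move: N0 lam0 lam1; clear; nra.
have qr' : (q <= r')%N.
  rewrite -(ler_nat R); apply: le_trans (ltW Yr'); apply: le_trans NY.
  by move: qN qR; clear; lra.
(* [L = lam / N^2] is [45 / 16 * Psi (N / 8)], the slack that the hypothesis on
   [omega] allows, and [1 / (18 Y^2) = lam^2 / (2 N^2)] is a small part of it. *)
pose a' := p%:~R / q%:R + N^-1 - L.
have cell_th x : cell a' r' x -> exists2 th, 3 / 4 * L <= th <= L &
    x = p%:~R / q%:R + N^-1 - th.
  move=> /andP[x1 x2]; exists (p%:~R / q%:R + N^-1 - x); last by ring.
  have : (18 * r'%:R ^+ 2)^-1 <= L / 4.
    apply: le_trans (_ : (18 * Y ^+ 2)^-1 <= _).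
      have Y2 : 0 < Y ^+ 2 by rewrite exprn_gt0.
      have YY : Y ^+ 2 <= r'%:R ^+ 2 by rewrite ler_pXn2r ?nnegrE ?ler0n// ltW.
      move: (_ ^+ 2) (_ ^+ 2) Y2 YY; clear => u v u0 uv.
      by rewrite lef_pV2 ?posrE; move: u0 uv; clear; lra.
    have -> : (18 * Y ^+ 2)^-1 = lam / 2 * L.
      by rewrite YE LE; field; rewrite !gt_eqF.
    by move: L0 lam1; clear; nra.
  by rewrite /a' in x1 x2 *; move: x1 x2; clear; lra.
have LN5 : L <= N^-1 / 5 by move: LN lam1 iN0; clear; nra.
(* [p / q] is at least a quarter of the cell away from its right end, so there is room for
   [1 / N]. *)
have N72 : N^-1 <= (72 * r1%:R ^+ 2)^-1.
  rewrite lef_pV2 ?posrE ?N0//; last by apply: mulr_gt0; rewrite ?ltr0n// exprn_gt0.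
  have : 3 * r1%:R <= 8 * q%:R :> R by rewrite -!natrM ler_nat.
  rewrite NE; move: r1R m1000; clear => r1R m1000 h.
  have : 9 * r1%:R ^+ 2 <= 64 * q%:R ^+ 2 :> R by nra.
  by have := sqr_ge0 (q%:R : R); nra.
have cell1 x : cell a' r' x -> cell a1 r1 x.
  move=> /cell_th[th hth ->]; rewrite /cell /=.
  have -> : (18 * r1%:R ^+ 2)^-1 = 4 * (72 * r1%:R ^+ 2)^-1 :> R.
    by field; rewrite gt_eqF.
  by move: pq N72 hth LN5 iN0 L0; clear; lra.
have dist_pq x : cell a' r' x -> N^-1 - L <= `|x - p%:~R / q%:R| <= N^-1.
  move=> /cell_th[th hth ->]; rewrite ger0_norm; move: hth LN5 iN0 L0; clear; lra.
(* Only finitely many denominators are below [r'], so the bound required by [E] also provides a gap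
   [d1 / t^2]. *)
have [d1 d10 hd1] : exists2 d1, 0 < d1 & forall t, (0 < t < r')%N ->
    d1 <= t%:R ^+ 2 * ((1 - omega t%:R) * Psi t%:R).
  apply: finite_pos_lower_bound => t t0.
  have tR : 0 < t%:R :> R by rewrite ltr0n.
  have /andP[_ w1] := omega_01 _ tR.
  by rewrite mulr_gt0 ?exprn_gt0// mulr_gt0 ?Psi_pos// subr_gt0.
exists a', (Num.min g d1), r'; split.
- by split => //; rewrite lt_min g0.
- by apply: leq_trans qr'; move: Kr1 r1q; clear; lia.
- move=> x t b cx /andP[t0 tr'].
  have tR : 0 < t%:R :> R by rewrite ltr0n.
  have t2 : 0 < t%:R ^+ 2 :> R by rewrite exprn_gt0.
  have [cx0 _ far] := ha1 _ (cell1 _ cx).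
  have /andP[w0 w1] := omega_01 _ tR.
  have wPsi : (1 - omega t%:R) * Psi t%:R <= Psi t%:R.
    by rewrite ler_piMl ?ltW ?Psi_pos//; move: w0; clear; lra.
  have gapP c : Num.min g d1 <= c -> c / t%:R ^+ 2 <= `|x - b%:~R / t%:R| ->
      Num.min g d1 / t%:R ^+ 2 <= `|x - b%:~R / t%:R|.
    by move=> gc; apply: le_trans; rewrite ler_wpM2r// invr_ge0 ltW.
  have [tr|rt] := ltnP t r.
    have t0r : (0 < t < r)%N by rewrite t0.
    have [h1 h2] := clr x t b cx0 t0r.
    by split=> //; apply: gapP h1; rewrite ge_min gd.
  have PsiE : Psi t%:R = t%:R ^+ 2 * Psi t%:R / t%:R ^+ 2 by field; rewrite gt_eqF.
  have [tr1|r1t] := ltnP t r1.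
    have rtr : (r <= t < r1)%N by rewrite rt.
    have h := far t b rtr.
    split; first by apply: gapP h; rewrite ge_min g1.
    move=> Tt; apply: le_trans wPsi _; apply: le_trans h.
    rewrite PsiE ler_wpM2r ?invr_ge0 ?(ltW t2)//.
    have TtR : T%:R <= t%:R :> R by rewrite ler_nat.
    by have := small_T _ TtR; clear; lra.
  suff main : (1 - omega t%:R) * Psi t%:R <= `|x - b%:~R / t%:R|.
    split=> //; apply: (gapP d1); first by rewrite ge_min lexx orbT.
    apply: le_trans main; rewrite ler_pdivrMr// mulrC.
    by apply: hd1; rewrite t0.
  have TtR : T%:R <= t%:R :> R.
    by rewrite ler_nat; move: Kr1 r1t; clear; lia.
  have f0 : 0 <= t%:R ^+ 2 * Psi t%:R by rewrite mulr_ge0// ltW ?Psi_pos.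
  have f1 := small_T _ TtR.
  have fqt : (q <= t)%N -> t%:R ^+ 2 * Psi t%:R <= m%:R^-1.
    by move=> qt; rewrite -fq; apply: Psi_noninc; rewrite // ler_nat.
  have [e|ne] := eqVneq (b * q%:Z) (p * t%:Z); last first.
    apply: le_trans wPsi _; rewrite PsiE.
    have [th hth ->] := cell_th _ cx.
    have qt192 : (q <= 192 * t)%N by move: qr1 r1t; clear; lia.
    rewrite -NN; apply: dist_near_new_fraction => //.
    + by move=> /fqt; rewrite -[m%:R^-1]div1r ler_pdivlMr.
    + by move: hth L0; clear; lra.
    + rewrite NN; have := r'Y _ tr'; rewrite YE ler_pdivlMr//.
      move=> tN; apply: le_trans (_ : 3 * t%:R * N * L <= _).
        have : 0 < t%:R * N by rewrite mulr_gt0.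
        by move: hth; clear; nra.
      have -> : 3 * t%:R * N * L = t%:R * (3 * lam) / N.
        by rewrite LE; field; rewrite gt_eqF.
      by rewrite ler_pdivrMr// mul1r.
    + move=> Nt; have NtR : N <= t%:R by rewrite -NN ler_nat.
      have : t%:R ^+ 2 * Psi t%:R <= f8.
        by rewrite f8E; apply: Psi_noninc; move: NtR N0; clear; lra.
      have : N ^+ 2 * L <= t%:R ^+ 2 * L.
        by rewrite ler_wpM2r ?(ltW L0)// ler_pXn2r ?nnegrE ?(ltW N0) ?(ltW tR).
      have -> : N ^+ 2 * L = 180 * f8 by rewrite LE lamE; field; rewrite gt_eqF.
      have : t%:R ^+ 2 * (3 / 4 * L) <= t%:R ^+ 2 * th.
        by rewrite ler_wpM2l ?(ltW t2)//; move: hth; clear; lra.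
      by move: f80; clear; lra.
  have eR : b%:~R * q%:R = p%:~R * t%:R :> R by rewrite !pmulrn -!intrM e.
  have ef : p%:~R / q%:R = b%:~R / t%:R :> R.
    by apply/eqP; rewrite eqr_div; [rewrite -eR|rewrite gt_eqF..].
  have pos_sep (t' : nat) (b' : int) : (0 < t' < q)%N -> p%:~R / q%:R != b'%:~R / t'%:R :> R.
    move=> /[dup] /andP[t'0 _] /(sep4 _ b') h; apply/eqP => e'; move: h.
    rewrite e' subrr normr0 leNgt => /negP; apply.
    by rewrite divr_gt0 ?exprn_gt0 ?ltr0n// divr_gt0.
  have qt : (q <= t)%N.
    rewrite leqNgt; apply/negP => tq.
    by have := pos_sep t b; rewrite t0 tq ef eqxx => /(_ isT).
  rewrite -ef; have /andP[dx _] := dist_pq _ cx; apply: le_trans dx.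
  (* For [t = q] the slack [L <= omega q / N] is just what is allowed. Otherwise [t >= 2 q], as
     [(b - p) / (t - q)] would be a smaller form of [p / q]; then [Psi t <= Psi q / 4], which is
     below [1 / N - L]. *)
  have [eqt|neqt] := eqVneq t q.
    rewrite eqt ePsi mulrBl mul1r lerD2l lerN2; exact: Lom.
  have t2q : (2 * q <= t)%N.
    rewrite leqNgt; apply/negP => t2q.
    have tq' : (0 < t - q < q)%N by move: qt neqt t2q q0; clear; lia.
    apply: (negP (pos_sep _ (b - p) tq')).
    have tqR : (t - q)%:R != 0 :> R by rewrite pnatr_eq0 -lt0n; case/andP: tq'.
    rewrite eqr_div ?tqR//; last by rewrite gt_eqF.
    by rewrite natrB// intrB mulrBr mulrBl eR.
  apply: le_trans wPsi _.
  have : Psi t%:R <= N^-1 / 4.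
    have t2qR : 2 * q%:R <= t%:R :> R by rewrite -natrM ler_nat.
    have h4 : 4 * q%:R ^+ 2 <= t%:R ^+ 2 :> R by move: t2qR qR; clear; nra.
    rewrite -(ler_pM2l t2); apply: le_trans (fqt qt) _.
    apply: le_trans (_ : 4 * q%:R ^+ 2 * (N^-1 / 4) <= _).
      by rewrite le_eqVlt; apply/orP; left; apply/eqP; rewrite NE; field; rewrite !gt_eqF.
    by rewrite ler_wpM2r//; move: iN0; clear; lra.
  by move: LN5 iN0; clear; lra.
- by move=> x /cell1 /ha1[].
- exists q, p; split => //; first by move: Kr1 r1q; clear; lia.
  by move=> x /dist_pq /andP[_]; rewrite ePsi.
Qed.

(** * Large arguments and unbounded denominators *)

Lemma near_pinfty_nat (R : realType) (P : R -> Prop) :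
  (\forall q \near +oo, P q) -> exists M : nat, forall q : R, M%:R <= q -> P q.
Proof.
move=> [M [_ hM]]; exists (Num.truncn M).+1 => q Mq; apply: hM.
by apply: lt_le_trans Mq; apply: truncnS_gt.
Qed.

(** For bounded [q] only finitely many [p] qualify, because [Psi q <= Psi 1] bounds [|p|] by
    [(|x| + Psi 1) q]. *)
Lemma W_unbounded (R : realType) (Psi : R -> R) (x : R) :
  (forall q r : R, 0 < q -> q <= r -> r ^+ 2 * Psi r <= q ^+ 2 * Psi q) ->
  (forall q : R, 0 < q -> 0 < Psi q) ->
  W Psi x <-> forall Q : nat, exists (q : nat) (p : int),
    [/\ (0 < q)%N, (Q <= q)%N & `|x - p%:~R / q%:R| <= Psi q%:R].
Proof.
move=> Psi_noninc Psi_pos; split => [Wx Q|h]; last first.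
  move=> /finite_seqP[s es].
  have [q [p [q0 Qq hq]]] := h (\max_(pq <- s) pq.2).+1.
  have /= ins : (p, q) \in s.
    have : [set` s] (p, q) by rewrite -es /=.
    by [].
  have := @leq_bigmax_seq _ s predT (fun pq => pq.2) _ ins isT.
  by rewrite leqNgt Qq.
apply: contrapT => none; apply: Wx.
pose C := (Num.truncn ((`|x| + Psi 1) * Q%:R)).+1.
pose s := [seq ((i%:Z - C%:Z)%R, q) | i <- iota 0 (2 * C).+1, q <- iota 0 Q].
apply: (@sub_finite_set _ _ [set` s]); last exact: finite_seq.
move=> [p q] /= [q0 hq].
have qQ : (q < Q)%N.
  by rewrite ltnNge; apply/negP => Qq; apply: none; exists q, p.
have qR : 1 <= q%:R :> R by rewrite ler1n.
have qR0 : 0 < q%:R :> R by rewrite ltr0n.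
have P1 : Psi q%:R <= Psi 1.
  have := Psi_noninc 1 q%:R ltr01 qR; rewrite expr1n mul1r; apply: le_trans.
  by rewrite ler_peMl ?(ltW (Psi_pos _ _))// expr2; nra.
have pC : (`|p| <= C)%N.
  have : `|p%:~R / q%:R| <= `|x| + Psi 1 :> R.
    rewrite -[p%:~R / _](subKr x); apply: le_trans (ler_normB _ _) _.
    by rewrite lerD2l (le_trans hq).
  rewrite normrM normfV (gtr0_norm qR0) ler_pdivrMr// => hp.
  have : `|p%:~R| < C%:R :> R.
    apply: le_lt_trans (truncnS_gt _); apply: le_trans hp _.
    by rewrite ler_wpM2l ?ler_nat 1?ltnW// addr_ge0// ltW// Psi_pos.
  by rewrite -intr_norm -abszE -pmulrn ltr_nat => /ltnW.
apply/allpairsP; exists (absz (p + C%:Z), q); rewrite !mem_iota /=.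
by split; [lia|lia|congr pair; lia].
Qed.

(** * A lower bound on [omega] forced by a point of [E] *)

Lemma E_lower_bound (R : realType) (Psi omega : R -> R) (x : R)
  (Psi_pos : forall q : R, 0 < q -> 0 < Psi q)
  (omega_01 : forall q : R, 0 < q -> 0 < omega q < 1)
  (Psi_noninc : forall q r : R, 0 < q -> q <= r ->
     r ^+ 2 * Psi r <= q ^+ 2 * Psi q)
  (Psi_sqdiv : square_divisibility Psi) (Q : nat) :
  E Psi omega x -> exists q : nat, [/\ (Q <= q)%N, (0 < q)%N,
    q%:R <= 1 / Psi q%:R &
    (1 - omega (1 / Psi q%:R)) / Psi q%:R * Psi (1 / Psi q%:R) <= omega q%:R].
Proof.
move=> [/W_unbounded-/(_ Psi_noninc Psi_pos) Wx [q0 far]].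
have [q [p [qpos Qq near_p]]] := Wx (maxn Q q0).
have [m m0 ePsi] := square_divisibilityP Psi_pos Psi_sqdiv qpos.
pose N := (q ^ 2 * m)%N.
have qN : (q <= N)%N by rewrite /N expnS expn1 -mulnA leq_pmulr// muln_gt0 qpos.
have Npos : (0 < N)%N by apply: leq_trans qN.
have NR : 0 < N%:R :> R by rewrite ltr0n.
have qR : 0 < q%:R :> R by rewrite ltr0n.
have q0q : (q0 <= q)%N by apply: leq_trans Qq; apply: leq_maxr.
have iPsi : 1 / Psi q%:R = N%:R by rewrite ePsi div1r invrK.
exists q; split => //; first by apply: leq_trans Qq; apply: leq_maxl.
  by rewrite iPsi ler_nat.
rewrite iPsi.
have far_p := far q qpos q0q p.
have farN b : (1 - omega N%:R) * Psi N%:R <= `|x - b%:~R / N%:R|.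
  by apply: far => //; apply: leq_trans qN.
have pE : p%:~R / q%:R = (p * (q * m)%:Z)%:~R / N%:R :> R.
  rewrite /N natrM natrX intrM -pmulrn [(q * m)%:R]natrM; field.
  by rewrite !gt_eqF// ltr0n.
suff : (1 - omega N%:R) * Psi N%:R <= omega q%:R / N%:R.
  rewrite ePsi -/N invrK ler_pdivlMr// => h.
  by apply: le_trans h; rewrite le_eqVlt; apply/orP; left; apply/eqP; ring.
rewrite ePsi -/N in near_p far_p.
(* The fraction compared with [x] is the neighbour of [p / q] over [N] on the side of [x]. *)
have [xp|px] := leP 0 (x - p%:~R / q%:R).
  apply: le_trans (farN (p * (q * m)%:Z + 1)) _.
  rewrite intrD mulrDl -pE div1r opprD addrA ler_norml.
  by move: near_p far_p; rewrite ger0_norm// mulrBl mul1r; lra.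
apply: le_trans (farN (p * (q * m)%:Z - 1)) _.
rewrite intrB mulrBl -pE div1r opprB ler_norml.
by move: near_p far_p; rewrite ltr0_norm// mulrBl mul1r; lra.
Qed.

(** * Nested cells and their common point *)

Lemma exists_E_avoiding (R : realType) (Psi omega : R -> R) (T : nat)
  (Psi_pos : forall q : R, 0 < q -> 0 < Psi q)
  (omega_01 : forall q : R, 0 < q -> 0 < omega q < 1)
  (small : forall e : R, 0 < e -> exists M : nat, forall q : R,
     M%:R <= q -> q ^+ 2 * Psi q <= e)
  (Psi_noninc : forall q r : R, 0 < q -> q <= r ->
     r ^+ 2 * Psi r <= q ^+ 2 * Psi q)
  (Psi_sqdiv : square_divisibility Psi)
  (small_T : forall q : R, T%:R <= q -> q ^+ 2 * Psi q <= 1 / 1000)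
  (big : forall q : nat, (T <= q)%N ->
     45 / (16 * Psi q%:R) * Psi (1 / (8 * Psi q%:R)) <= omega q%:R)
  (y : nat -> R) :
  exists2 x, E Psi omega x & forall n, x != y n.
Proof.
pose good (s : R * nat * R) := [/\ (0 < s.1.2)%N, 0 < s.2 &
  clears Psi omega T s.1.1 s.1.2 s.2].
(* At scale 1 there is no denominator to clear. *)
have good0 : good (0, 1%N, 1) by split => //= x t b _; case: t => [|[]].
pose P (ns : nat * {s | good s}) (s' : {s | good s}) :=
  let c := sval ns.2 in let c' := sval s' in [/\ (ns.1 <= c'.1.2)%N,
    forall x, cell c'.1.1 c'.1.2 x -> cell c.1.1 c.1.2 x /\ x != y ns.1 &
    exists (q : nat) (p : int), [/\ (0 < q)%N, (ns.1 <= q)%N &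
      forall x, cell c'.1.1 c'.1.2 x -> `|x - p%:~R / q%:R| <= Psi q%:R]].
have [F hF] : {F & forall ns, P ns (F ns)}.
  apply: choice => -[n [[[a r] d] gs]]; have [r0 d0 clr] := gs.
  have [a' [d' [r' [[r'0 d'0] nr' clr' sub pq]]]] :=
    clears_step Psi_pos omega_01 small Psi_noninc Psi_sqdiv small_T big
      (y n) n r0 d0 clr.
  have gs' : good (a', r', d') by split.
  by exists (exist _ (a', r', d') gs').
pose S := nat_rect (fun=> {s | good s}) (exist _ _ good0) (fun n s => F (n, s)).
pose a n := (sval (S n)).1.1; pose r n := (sval (S n)).1.2.
pose len n : R := (18 * (r n)%:R ^+ 2)^-1.
have step n : P (n, S n) (S n.+1) by exact: hF.
have len0 n : 0 <= len n by rewrite invr_ge0 mulr_ge0// exprn_ge0// ler0n.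
have own n : cell (a n) (r n) (a n) by rewrite /cell /= lexx lerDl len0.
have nested m n : (m <= n)%N -> cell (a n) (r n) `<=` cell (a m) (r m).
  elim: n => [|n IH]; first by rewrite leqn0 => /eqP ->.
  rewrite leq_eqVlt => /predU1P[->//|mn] x cx; apply: IH => //.
  by have [_ /(_ x cx)[]] := step n.
have a_le m n : a m <= a n + len n.
  have [/nested/(_ _ (own n))/andP[h _]|/ltnW/nested/(_ _ (own m))/andP[_ //]] := leqP m n.
  by apply: le_trans h _; rewrite lerDl.
have bound n : ubound (range a) (a n + len n) by move=> _ [m _ <-].
have supA : has_sup (range a) by split; [exists (a 0%N), 0%N|exists (a 0%N + len 0%N)].
pose x := sup (range a).
have xin n : cell (a n) (r n) x.
  apply/andP; split; first by apply: ub_le_sup; [exact: supA.2|exists n].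
  by apply: ge_sup; [exact: supA.1|exact: bound].
exists x; last by move=> n; have [_ /(_ x (xin n.+1))[]] := step n.
split.
  apply/(W_unbounded _ Psi_noninc Psi_pos) => Q.
  have [_ _ [q [p [q0 Qq hq]]]] := step Q.
  by exists q, p; split => //; apply: hq; apply: xin.
exists T => q q0 Tq p.
(* Step [q + 1] produces state [q + 2] with scale at least [q + 1], hence above [q]. *)
have [_ _ clr] := svalP (S q.+2).
have [rq _ _] := step q.+1.
have qr : (0 < q < (sval (S q.+2)).1.2)%N by rewrite q0.
by have [_] := clr x q p (xin q.+2) qr; apply.
Qed.

Theorem theorem1p3 (R : realType) (Psi omega : R -> R)
  (Psi_pos : forall q : R, 0 < q -> 0 < Psi q)
  (omega_01 : forall q : R, 0 < q -> 0 < omega q < 1)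
  (Psi_lim : q ^+ 2 * Psi q @[q --> +oo] --> (0 : R))
  (omega_lim : omega q @[q --> +oo] --> (0 : R))
  (Psi_noninc : forall q r : R, 0 < q -> q <= r ->
     r ^+ 2 * Psi r <= q ^+ 2 * Psi q)
  (Psi_sqdiv : square_divisibility Psi) :
  (((\forall q \near +oo,
       omega q < (1 - omega (1 / Psi q)) / Psi q * Psi (1 / Psi q)) ->
     E Psi omega = set0) /\
   ((exists c : R, 0 < c < 1 /\
       \forall q \near +oo, omega q < c / Psi q * Psi (1 / Psi q)) ->
     E Psi omega = set0)) /\
  ((\forall q \near +oo,
      45 / (16 * Psi q) * Psi (1 / (8 * Psi q)) <= omega q) ->
    E Psi omega !=set0 /\ ~ countable (E Psi omega)).
Proof.
have small (e : R) : 0 < e -> exists M : nat, forall q : R,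
    M%:R <= q -> q ^+ 2 * Psi q <= e.
  move=> e0; have [M hM] := near_pinfty_nat (cvgr0_norm_le _ Psi_lim _ e0).
  by exists M => q Mq; apply: le_trans (hM _ Mq); apply: ler_norm.
have nat_pos (M q : nat) : (M <= q)%N -> M%:R <= q%:R :> R by rewrite ler_nat.
split; first split.
- move=> /near_pinfty_nat[M hM]; apply/seteqP; split => // x Ex.
  have [q [Mq q0 _]] := E_lower_bound Psi_pos omega_01 Psi_noninc Psi_sqdiv M Ex.
  by rewrite leNgt hM// ler_nat.
- move=> [c [/andP[c0 c1] /near_pinfty_nat[M hM]]]; apply/seteqP; split => // x Ex.
  have c1' : 0 < 1 - c by rewrite subr_gt0.
  (* Once [omega (1 / Psi q) <= 1 - c], the bound with [c] implies the one with
     [1 - omega (1 / Psi q)]. *)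
  have [M' hM'] := near_pinfty_nat (cvgr0_norm_le _ omega_lim _ c1').
  have [q [Mq q0 qN]] :=
    E_lower_bound Psi_pos omega_01 Psi_noninc Psi_sqdiv (maxn M M') Ex.
  move: Mq; rewrite geq_max => /andP[Mq M'q].
  have qR : 0 < q%:R :> R by rewrite ltr0n.
  have Pq := Psi_pos _ qR.
  have N0 : 0 < 1 / Psi q%:R by rewrite divr_gt0.
  rewrite leNgt => /negP; apply.
  apply: lt_le_trans (hM _ (nat_pos _ _ Mq)) _.
  rewrite ler_wpM2r ?(ltW (Psi_pos _ N0))// ler_wpM2r ?invr_ge0 ?(ltW Pq)//.
  have : `|omega (1 / Psi q%:R)| <= 1 - c by apply: hM'; apply: le_trans qN; apply: nat_pos.
  by move=> /(le_trans (ler_norm _)); lra.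
- move=> /near_pinfty_nat[M hM].
  have e0 : 0 < 1 / 1000 :> R by lra.
  have [M' hM'] := small _ e0.
  have avoid (y : nat -> R) : exists2 x, E Psi omega x & forall n, x != y n.
    apply: (exists_E_avoiding Psi_pos omega_01 small Psi_noninc Psi_sqdiv (T := maxn M M')).
      by move=> q; rewrite natr_max ge_max => /andP[_ /hM'].
    by move=> q; rewrite geq_max => /andP[Mq _]; apply: hM; apply: nat_pos.
  split; first by have [x Ex _] := avoid (fun=> 0); exists x.
  have [x0 Ex0 _] := avoid (fun=> 0).
  (* If [E] were countable and non-empty, some sequence [f] would exhaust it, but [avoid f] gives a
     point of [E] outside. *)
  move=> /pfcard_geP[E0|[f]]; first by move: Ex0; rewrite E0.
  have [x Ex xf] := avoid f.
  have [n _ fn] := @surj _ _ _ _ f _ Ex.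
  by have := xf n; rewrite fn eqxx.
Qed.
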